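(* Let $n \ge 1$, let $A \in M_n(\mathbb{C})$ be a positive semi-definite matrix, and let $\alpha_1, \ldots, \alpha_k$ be non-empty sets forming a partition of $\{1, 2, \ldots, n\}$. Then $$\mathrm{rank}(A) \le \sum_{i=1}^k \mathrm{rank}(A[\alpha_i]),$$ with equality if and only if the range projection $\mathfrak{R}[A]$ is block diagonal with respect to the partition, i.e. $\mathfrak{R}[A][\alpha_\ell, \alpha_m] = 0$ for all $1 \le \ell, m \le k$ with $\ell \ne m$.
   Context: For a matrix $B \in M_n(\mathbb{C})$ and non-empty $\alpha, \beta \subseteq \{1, \ldots, n\}$, $B[\alpha, \beta]$ denotes the submatrix of $B$ given by the rows indexed by $\alpha$ and the columns indexed by $\beta$, and $B[\alpha] := B[\alpha, \alpha]$. The range projection $\mathfrak{R}[A]$ is the matrix of the orthogonal projection of $\mathbb{C}^n$ onto the range (column space) of $A$. The block diagonality condition is the same as membership of $\mathfrak{R}[A]$ in the subalgebra $M_{n_1}(\mathbb{C}) \oplus \cdots \oplus M_{n_k}(\mathbb{C})$ of $M_n(\mathbb{C})$ determined by the partition, where $n_i = \#(\alpha_i)$. *)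

(* Defs.v *)
From mathcomp Require Import all_boot all_order all_algebra.
From mathcomp Require Import sesquilinear spectral complex reals.

Set Implicit Arguments.
Unset Strict Implicit.
Unset Printing Implicit Defensive.

Import Order.TTheory GRing.Theory Num.Theory.
Local Open Scope ring_scope.
Local Open Scope sesquilinear_scope.

(* The order on [C] is partial: [0 <= z] means that [z] is real and
   nonnegative. *)
Definition psdmx (C : numClosedFieldType) n (A : 'M[C]_n) : Prop :=
  A \is hermsymmx /\ forall v : 'cV[C]_n, 0 <= (v^t* *m A *m v) 0 0.

Definition submatrix (C : Type) n (B : 'M[C]_n) (a b : {set 'I_n}) :
    'M[C]_(#|a|, #|b|) :=
  mxsub (@enum_val _ (mem a)) (@enum_val _ (mem b)) B.

(* [proj_ortho U] acts on row vectors, from the right, and projects onto the row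
   space of [U]; transposing on both sides yields the matrix that acts on column
   vectors, from the left, and projects onto the column space of [A]. *)
Definition range_proj (C : numClosedFieldType) n (A : 'M[C]_n) : 'M[C]_n :=
  (proj_ortho A^T)^T.

Lemma range_proj_range (C : numClosedFieldType) n (A : 'M[C]_n) (v : 'cV[C]_n) :
  exists u : 'cV[C]_n, range_proj A *m v = A *m u.
Proof.
have /submxP[D eD] := proj_ortho_sub A^T v^T.
by exists D^T; apply: trmx_inj; rewrite !trmx_mul !trmxK eD.
Qed.

Lemma range_proj_orthogonal (C : numClosedFieldType) n (A : 'M[C]_n)
    (v : 'cV[C]_n) :
  A^t* *m (v - range_proj A *m v) = 0.
Proof.
have /orthomx1P e := proj_ortho_compl_sub A^T v^T.
apply: trmx_inj; rewrite trmx0 -[RHS]e trmx_mul !linearB /= trmx_mul trmxK.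
by rewrite map_trmx !trmxK.
Qed.

(* Main.v *)
(* If [A] is positive semi-definite, then [rank A[S] = rank (D A)], where [D] is
   the coordinate projection onto [S], because [u A u^* = 0] forces [u A = 0].
   With [D_i] the coordinate projections of the partition, [A = sum_i D_i A], so
   [rank A <= sum_i rank (D_i A)], with equality iff the row spaces of the
   [D_i A] are in direct sum, i.e. iff the left kernel of [A] is stable under
   every [D_i].  That kernel is the one of the orthogonal projection [P] onto the
   range of [A], and a subspace is stable under a Hermitian matrix [D_i] iff its
   orthogonal projection commutes with [D_i]. *)
Require Import Defs.
From mathcomp Require Import all_boot all_order all_algebra.
From mathcomp Require Import sesquilinear spectral complex reals.
From mathcomp Require Import ring.

Set Implicit Arguments.
Unset Strict Implicit.
Unset Printing Implicit Defensive.

Import Order.TTheory GRing.Theory Num.Theory.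
Local Open Scope ring_scope.
Local Open Scope complex_scope.

(** * Ranks and orthogonal idempotents with sum the identity *)

Section ResolutionOfIdentity.
Variables (F : fieldType) (n k : nat) (D : 'I_k -> 'M[F]_n).
Hypotheses (sumD : \sum_i D i = 1%:M)
  (DD : forall i j, D i *m D j = if i == j then D i else 0).

(** The row space of [A] is the sum of those of the [D i *m A]: the [D i] sum to the identity, and
    each [D i *m A] is a left multiple of [A]. *)
Lemma mxrank_resolution_leqif (A : 'M_n) :
  (\rank A <= \sum_i \rank (D i *m A) ?= iff mxdirect (\sum_i (D i *m A)))%N.
Proof.
have -> : \rank A = \rank (\sum_i (D i *m A))%MS; last first.
  exact: mxrank_sum_leqif.
apply/eqmx_rank/andP; split.
  rewrite -[X in (X <= _)%MS]mul1mx -sumD mulmx_suml.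
  by apply: summx_sub_sums => i _; apply: submx_refl.
by apply/sumsmx_subP => i _; apply: submxMl.
Qed.

Lemma mxdirect_resolutionP (A : 'M_n) :
  mxdirect (\sum_i (D i *m A)) <->
  forall m (W : 'M_(m, n)), W *m A = 0 -> forall i, W *m D i *m A = 0.
Proof.
split=> [dxA m W WA0 i | stabA].
  have: (0 : 'M_(m, n)) = \sum_j W *m D j *m A.
    by rewrite -mulmx_suml -mulmx_sumr sumD mulmx1.
  (* In a direct sum zero decomposes uniquely, so the terms [W *m D j *m A], which sum to zero, all
     vanish. *)
  have [C _ _ uniqC] := sub_dsumsmx dxA (sub0mx m _) => eW.
  rewrite (uniqC (fun j => W *m D j *m A)) //.
    by rewrite -(uniqC (fun _ => 0)) ?big1 // => j _; apply: sub0mx.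
  by move=> j _; rewrite -mulmxA submxMl.
apply/mxdirect_sumsP => i _; apply/eqP; rewrite -submx0.
set S := (\sum_(_ | _) _)%MS.
have /submxP[x ex] := capmxSl (D i *m A) S.
have /sub_sumsmxP[y ey] := capmxSr (D i *m A) S.
(* [W] compares two expressions of the intersection, one from each side, so it kills [A];
   orthogonality of the [D j] reduces [W *m D i] to [x *m D i], and stability applies. *)
pose W := x *m D i - \sum_(j | j != i) y j *m D j.
have WA0 : W *m A = 0.
  rewrite mulmxBl -mulmxA -ex mulmx_suml [X in X - _]ey.
  by apply/eqP; rewrite subr_eq0; apply/eqP/eq_bigr => j _; rewrite mulmxA.
suff eW : W *m D i = x *m D i by rewrite ex mulmxA -eW stabA.
rewrite mulmxBl mulmx_suml big1 ?subr0 -?mulmxA ?DD ?eqxx // => j /negPf ij.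
by rewrite -mulmxA DD ij mulmx0.
Qed.

End ResolutionOfIdentity.

(** * Submatrices and coordinate projections *)

Section CoordinateSelection.
Variables (F : fieldType) (n : nat).
Implicit Types (S T : {set 'I_n}).

Definition selmx S : 'M[F]_(#|S|, n) :=
  rowsub (@enum_val _ (mem S)) 1%:M.

Definition coordproj S : 'M[F]_n := (selmx S)^T *m selmx S.

Lemma submatrixE (B : 'M_n) S T :
  submatrix B S T = selmx S *m B *m (selmx T)^T.
Proof.
rewrite /selmx -rowsubE; apply: trmx_inj.
rewrite trmx_mul trmxK -rowsubE.
by apply/matrixP => i j; rewrite !mxE.
Qed.

Lemma selmxK S : selmx S *m (selmx S)^T = 1%:M.
Proof.
rewrite -[selmx S in X in X *m _]mulmx1 -submatrixE.
by apply/matrixP => i j; rewrite !mxE (inj_eq enum_val_inj).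
Qed.

Lemma selmx_disjoint S T : [disjoint S & T] -> selmx S *m (selmx T)^T = 0.
Proof.
move=> dST; rewrite -[selmx S]mulmx1 -submatrixE.
apply/matrixP => i j; rewrite !mxE; case: eqP => // eij.
by have /negP[] := disjointFr dST (enum_valP i); rewrite eij enum_valP.
Qed.

Lemma coordprojE S a b : coordproj S a b = ((a == b) && (a \in S))%:R.
Proof.
rewrite mxE.
under eq_bigr => s _ do rewrite !mxE.
(* The sum over the rows of [selmx S] becomes a sum over the elements of [S]. *)
rewrite -(big_enum_val (A := mem S) (fun c => (c == a)%:R * (c == b)%:R)) /=.
case: (boolP (a \in S)) => aS; last first.
  rewrite andbF big1 // => c cS; case: eqP => [eca|]; last by rewrite mul0r.
  by rewrite -eca cS in aS.
rewrite andbT (bigD1 a) //= eqxx mul1r big1 ?addr0 // => c /andP[_ /negPf->].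
by rewrite mul0r.
Qed.

Variables (k : nat) (alpha : 'I_k -> {set 'I_n}).
Hypotheses
  (disj : forall i j, i != j -> [disjoint alpha i & alpha j])
  (cover : \bigcup_(i < k) alpha i = [set: 'I_n]).

Lemma coordproj_mul i j :
  coordproj (alpha i) *m coordproj (alpha j) =
  if i == j then coordproj (alpha i) else 0.
Proof.
rewrite /coordproj mulmxA -[_ *m _ *m _^T]mulmxA.
case: eqP => [<-|/eqP ij]; first by rewrite selmxK mulmx1.
by rewrite selmx_disjoint ?disj // mulmx0 mul0mx.
Qed.

Lemma sum_coordproj : \sum_i coordproj (alpha i) = 1%:M.
Proof.
apply/matrixP => a b; rewrite summxE mxE.
under eq_bigr => i _ do rewrite coordprojE.
have /bigcupP[i _ ai] : a \in \bigcup_(i < k) alpha i by rewrite cover inE.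
rewrite (bigD1 i) //= ai andbT big1 ?addr0 // => j ji.
by rewrite (disjointFl (disj ji) ai) andbF.
Qed.

Lemma offdiag_blocks0P (P : 'M[F]_n) :
  (forall l m : 'I_k, l != m -> submatrix P (alpha l) (alpha m) = 0) <->
  forall i, coordproj (alpha i) *m P = P *m coordproj (alpha i).
Proof.
split=> [P0 i | cP l m lm]; last first.
  rewrite submatrixE -[selmx _ in X in X *m _ *m _]mul1mx -(selmxK (alpha l)).
  rewrite -[_ *m selmx _]mulmxA -[_ *m _ *m P]mulmxA cP -!mulmxA.
  by rewrite selmx_disjoint ?disj // !mulmx0.
have blk l m : l != m ->
    coordproj (alpha l) *m P *m coordproj (alpha m) = 0.
  move=> lm; have := P0 l m lm; rewrite submatrixE /coordproj => e0.
  by rewrite mulmxA -[_ *m selmx _ *m P]mulmxA -[_ *m _ *m _^T]mulmxA e0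
             mulmx0 mul0mx.
(* Inserting the resolution of the identity on the free side of either product leaves only the
   diagonal block. *)
transitivity (coordproj (alpha i) *m P *m coordproj (alpha i)).
  rewrite -[LHS]mulmx1 -sum_coordproj mulmx_sumr (bigD1 i) //= big1 ?addr0 //.
  by move=> j ji; rewrite blk // eq_sym.
rewrite -[RHS]mul1mx -sum_coordproj mulmx_suml (bigD1 i) //= big1 ?addr0.
  by rewrite mulmxA.
by move=> j ji; rewrite mulmxA blk.
Qed.

End CoordinateSelection.

(** * Isotropic vectors and the range projection *)

Section PositiveSemidefinite.
Local Open Scope sesquilinear_scope.
Variables (C : numClosedFieldType) (n : nat).
Implicit Types (A : 'M[C]_n).

Lemma trmxC_mul m p q (A : 'M[C]_(m, p)) (B : 'M[C]_(p, q)) :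
  (A *m B)^t* = B^t* *m A^t*.
Proof. by rewrite trmx_mul map_mxM. Qed.

Lemma hermsymmxE A : A \is hermsymmx -> A^t* = A.
Proof. by move/is_hermitianmxP; rewrite expr0 scale1r => <-. Qed.

Lemma selmx_trmxC (S : {set 'I_n}) : (selmx C S)^t* = (selmx C S)^T.
Proof. by apply/matrixP => i j; rewrite !mxE rmorph_nat. Qed.

Lemma coordproj_trmxC (S : {set 'I_n}) : (coordproj C S)^t* = coordproj C S.
Proof.
by rewrite trmxC_mul selmx_trmxC -[X in X^t*]selmx_trmxC trmxCK.
Qed.

Lemma psdmx_row_ge0 A (u : 'rV_n) : psdmx A -> 0 <= (u *m A *m u^t*) 0 0.
Proof. by move=> [_ /(_ (u^t*))]; rewrite trmxCK. Qed.

(* The isotropic vector [u] is perturbed to [w = s u - d z] with [z = u A],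
   [d = |z|^2] and [s = z A z^* + 1]; the form at [w] is [- d^2 (s + 1)]. *)
Lemma psdmx_isotropic A (u : 'rV_n) :
  psdmx A -> u *m A *m u^t* = 0 -> u *m A = 0.
Proof.
move=> psdA uAu0; have [/hermsymmxE Ah _] := psdA.
set z := u *m A; pose d := dotmx z z; pose c := (z *m A *m z^t*) 0 0.
have c_ge0 : 0 <= c by apply: psdmx_row_ge0.
have d_ge0 : 0 <= d by apply: (dnorm_ge0 (@dotmx C n)).
apply/eqP; rewrite -(dnorm_eq0 (@dotmx C n)) -/d.
have dE : z *m z^t* = d%:M by rewrite [LHS]mx11_scalar -dotmxE.
have cE : z *m A *m z^t* = c%:M by rewrite [LHS]mx11_scalar.
have zAu : z *m A *m u^t* = d%:M by rewrite -mulmxA -{1}Ah -trmxC_mul.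
pose w : 'rV_n := (c + 1) *: u - d *: z.
have wC : w^t* = (c + 1) *: u^t* - d *: z^t*.
  apply/matrixP => i j; rewrite !mxE rmorphB !rmorphM /=.
  by rewrite (geC0_conj d_ge0) geC0_conj // addr_ge0.
have := psdmx_row_ge0 w psdA.
rewrite wC mulmxBr mulmxBl -!scalemxAl -!scalemxAr mulmxBl -!scalemxAl.
rewrite mulmxBl -!scalemxAl -/z uAu0 dE zAu cE !mxE !mulr1n => ge0.
have: 0 <= - (d ^+ 2 * (c + 2)).
  by apply: le_trans ge0 _; rewrite le_eqVlt; apply/orP; left; apply/eqP; ring.
rewrite oppr_ge0 => le0.
have: d ^+ 2 * (c + 2) == 0.
  by rewrite eq_le le0 mulr_ge0 ?exprn_ge0 ?addr_ge0 ?ler0n.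
by rewrite mulf_eq0 expf_eq0 /= [c + 2 == 0]gt_eqF ?orbF // ltr_wpDl ?ltr0n.
Qed.

(** With [E = selmx C S], the matrices [E^T *m E *m A] and [E *m A] have the same row space since
    [E *m E^T = 1]. Multiplying [E *m A] by [E^T] on the right loses no rank: if [x *m E *m A] is
    killed, then [x *m E] is isotropic. *)
Lemma psdmx_rank_submatrix A (S : {set 'I_n}) :
  psdmx A -> \rank (submatrix A S S) = \rank (coordproj C S *m A).
Proof.
move=> psdA; rewrite submatrixE.
have -> : \rank (coordproj C S *m A) = \rank (selmx C S *m A).
  apply/eqmx_rank/andP; split; first by rewrite -mulmxA submxMl.
  by rewrite -[X in (X *m A <= _)%MS]mul1mx -(selmxK C S) -!mulmxA submxMl.
apply/mxrank_injP/rowV0Pn => -[v]; rewrite sub_capmx => /andP[/submxP[x ->]].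
move/sub_kermxP => xE0; apply/negP; rewrite negbK mulmxA; apply/eqP.
apply: psdmx_isotropic => //.
by rewrite trmxC_mul selmx_trmxC !mulmxA in xE0 *; rewrite xE0 mul0mx.
Qed.

Lemma mulmx_range_proj A : A \is hermsymmx -> A *m range_proj A = A.
Proof.
move=> /hermsymmxE Ah; apply/eqP; rewrite -subr_eq0; apply/eqP/matrixP => i j.
have := range_proj_orthogonal A (delta_mx j 0).
rewrite Ah mulmxBr mulmxA -mulmxBl => /matrixP/(_ i 0).
by rewrite -colE !mxE => /eqP; rewrite subr_eq0 eq_sym -subr_eq0 => /eqP.
Qed.

Lemma range_proj_sub A : exists X, range_proj A = A *m X.
Proof.
have /submxP[X eX] := proj_ortho_sub A^T 1%:M.
by exists X^T; rewrite /range_proj -[proj_ortho _]mul1mx eX trmx_mul trmxK.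
Qed.

(** Writing [P = A *m X], the identity [A *m P = A] gives [P^t* *m P = P^t*], whose left side is
    self-adjoint. *)
Lemma range_proj_trmxC A :
  A \is hermsymmx -> (range_proj A)^t* = range_proj A.
Proof.
move=> Ah; have [X eX] := range_proj_sub A.
have eP : (range_proj A)^t* *m range_proj A = (range_proj A)^t*.
  rewrite {1 3}eX trmxC_mul (hermsymmxE Ah) -mulmxA.
  by rewrite mulmx_range_proj.
by rewrite -[RHS]trmxCK -[in RHS]eP trmxC_mul trmxCK eP.
Qed.

Lemma range_proj_ker A m (W : 'M_(m, n)) :
  A \is hermsymmx -> (W *m A = 0) <-> (W *m range_proj A = 0).
Proof.
move=> Ah; split=> W0.
  by have [X ->] := range_proj_sub A; rewrite mulmxA W0 mul0mx.
have <- : range_proj A *m A = A.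
  rewrite -[LHS]trmxCK trmxC_mul range_proj_trmxC // (hermsymmxE Ah).
  by rewrite mulmx_range_proj // (hermsymmxE Ah).
by rewrite mulmxA W0 mul0mx.
Qed.

Lemma range_proj_idem A : range_proj A *m range_proj A = range_proj A.
Proof. by rewrite /range_proj -trmx_mul proj_ortho_proj. Qed.

Lemma range_proj_commP A (D : 'M[C]_n) : A \is hermsymmx -> D^t* = D ->
  D *m range_proj A = range_proj A *m D <->
  forall m (W : 'M_(m, n)), W *m A = 0 -> W *m D *m A = 0.
Proof.
move=> Ah Dh; set P := range_proj A; have PP := range_proj_idem A.
split=> [DP m W /(range_proj_ker _ Ah) WP0 | stab].
  by apply/(range_proj_ker _ Ah); rewrite -mulmxA DP mulmxA WP0 mul0mx.
(* The rows of [1%:M - P] lie in the left kernel of [A]. Stability yields [D *m P = P *m D *m P],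
   and taking adjoints gives the same value for [P *m D]. *)
have /(range_proj_ker _ Ah) : (1%:M - P) *m D *m A = 0.
  by apply/stab/(range_proj_ker _ Ah); rewrite mulmxBl mul1mx PP subrr.
rewrite -/P !mulmxBl mul1mx => /eqP; rewrite subr_eq0 => /eqP eDP.
have := congr1 (fun M => M^t*) eDP.
by rewrite !trmxC_mul Dh range_proj_trmxC // -/P mulmxA -eDP.
Qed.

End PositiveSemidefinite.

Theorem corollary3p4 (R : realType) (n : nat) (n_ge1 : (1 <= n)%N)
    (A : 'M[R[i]]_n) (A_psd : psdmx A)
    (k : nat) (alpha : 'I_k -> {set 'I_n})
    (alpha_neq0 : forall i : 'I_k, alpha i != set0)
    (alpha_disjoint : forall i j : 'I_k, i != j -> [disjoint alpha i & alpha j])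
    (alpha_cover : \bigcup_(i < k) alpha i = [set: 'I_n]) :
  (\rank A <= \sum_(i < k) \rank (submatrix A (alpha i) (alpha i)))%N /\
  (\rank A = (\sum_(i < k) \rank (submatrix A (alpha i) (alpha i)))%N <->
   forall l m : 'I_k, l != m ->
     submatrix (range_proj A) (alpha l) (alpha m) = 0).
Proof.
have [Ah _] := A_psd.
under eq_bigr => i _ do rewrite psdmx_rank_submatrix //.
have sumD := sum_coordproj R[i] alpha_disjoint alpha_cover.
have DD := coordproj_mul R[i] alpha_disjoint.
have le_rank := mxrank_resolution_leqif sumD A.
split; first exact: le_rank.1.
have eq_rank : \rank A = (\sum_i \rank (coordproj _ (alpha i) *m A))%N <->
    mxdirect (\sum_i (coordproj _ (alpha i) *m A)).
  by rewrite -le_rank.2; split=> /eqP.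
(* Both sides are now conditions on each coordinate projection, matched one index at a time. *)
rewrite eq_rank mxdirect_resolutionP // offdiag_blocks0P //.
split=> [stab i | comm m W WA0 i].
  apply/range_proj_commP => // [|m W WA0]; first exact: coordproj_trmxC.
  exact: stab.
move: m W WA0; apply/range_proj_commP => //; exact: coordproj_trmxC.
Qed.
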